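(* Let $\beta \colon \mathbb{N} \to \mathbb{N}$ be a function. Then there are at most finitely many isomorphism types of finitely generated Abelian groups $G$ that have a finite monoid generating set $S$ with $\beta_{G,S} = \beta$.
   Context: $\mathbb{N}$ contains $0$. For a finitely generated group $G$ with neutral element $e$ and a finite monoid generating set $S \subset G$ (not necessarily symmetric; every element of $G$ is a finite, possibly empty, product of elements of $S$), define $d_S(g,h) := \min\{ n \in \mathbb{N} \mid \exists s_1,\dots,s_n \in S : h^{-1} g = s_1 \cdots s_n\}$ for $g,h \in G$. The ball of radius $r \in \mathbb{N}$ is $B_{G,S}(r) := \{ g \in G \mid d_S(g,e) \le r\}$, and the growth function of $G$ with respect to $S$ is $\beta_{G,S} \colon \mathbb{N} \to \mathbb{N}$, $\beta_{G,S}(r) := |B_{G,S}(r)|$. *)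

(* Defs.v *)
From mathcomp Require Import all_boot all_order finmap.
From mathcomp Require Import boolp classical_sets functions cardinality.

Set Implicit Arguments.
Unset Strict Implicit.
Unset Printing Implicit Defensive.

Local Open Scope group_scope.

Definition is_word_product (G : groupType) (S : {fset G}) (n : nat) (g : G) :
    Prop :=
  exists s : n.-tuple G, {subset s <= S} /\ g = \prod_(x <- s) x.

Definition monoid_generates (G : groupType) (S : {fset G}) : Prop :=
  forall g : G, exists n : nat, is_word_product S n g.

Definition finitely_generated (G : groupType) : Prop :=
  exists X : {fset G}, monoid_generates (X `|` [fset x^-1 | x in X])%fset.

Lemma word_dist_ex (G : groupType) (S : {fset G}) (hS : monoid_generates S)
    (g h : G) :
  exists n : nat, `[< is_word_product S n (h^-1 * g) >].
Proof. by have [n hn] := hS (h^-1 * g); exists n; apply/asboolP. Qed.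

(* The minimum exists because S generates, hence the dependency on hS; by
   [ex_minnP] the value does not depend on the proof hS.                      *)
Definition word_dist (G : groupType) (S : {fset G}) (hS : monoid_generates S)
    (g h : G) : nat :=
  ex_minn (word_dist_ex hS g h).

Definition word_ball (G : groupType) (S : {fset G}) (hS : monoid_generates S)
    (r : nat) : set G :=
  [set g | (word_dist hS g 1 <= r)%N]%classic.

(* [fset_set] is the junk value [fset0] on infinite sets; this lemma ensures
   that [growth] below never meets that case.                                 *)
Lemma finite_word_ball (G : groupType) (S : {fset G})
    (hS : monoid_generates S) (r : nat) :
  finite_set (word_ball hS r).
Proof.
pose W n : set G := range (fun t : n.-tuple S => \prod_(x <- map val t) x).
apply: (@sub_finite_set _ _ (\bigcup_(n in `I_r.+1) W n)%classic).
  move=> g; rewrite /word_ball /= /word_dist; case: ex_minnP => n.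
  rewrite invg1 mul1g => /asboolP[s [sS ->]] _ le_nr; exists n => //=.
  exists [tuple [` sS _ (mem_tnth i s)]%fset | i < n] => //=.
  congr (\prod_(x <- _) x); rewrite -map_comp -[RHS]map_tnth_enum.
  exact: eq_map.
apply: bigcup_finite => [|n _]; first exact: finite_II.
exact/finite_image/finite_finset.
Qed.

Definition growth (G : groupType) (S : {fset G}) (hS : monoid_generates S) :
    nat -> nat :=
  fun r => #|` fset_set (word_ball hS r)|%fset.

Definition isomorphic (G H : groupType) : Prop :=
  exists f : {multiplicative G -> H}, bijective f.

(* Main.v *)
Require Import Defs.
From mathcomp Require Import all_boot all_order finmap.
From mathcomp Require Import boolp classical_sets functions cardinality.
From HB Require Import structures.
From mathcomp Require Import all_algebra.

(** Fix $n = \beta(1)$, the size of the ball of radius $1$; every pair $(G, S)$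
    with growth $\beta$ provides a family of $n$ generators of $G$, hence a
    presentation of $G$ as the quotient of $\mathbb{Z}^n$ by a subgroup $K$.
    The isomorphism type of $G$ depends on $K$ only ([kernel_isomorphic]), so
    that it suffices to bound the number of possible subgroups $K$.

    For a subgroup $H$ of $\mathbb{Z}^n$, consider the possible $K$ that
    contain $H$.  There are finitely many of them, by Noetherian induction on
    $H$ ([noetherian_lattice]).  Either, for some radius $r$, all of these $K$
    identify two words of length at most $r$ that are distinct modulo $H$: then
    each of them contains one of finitely many vectors outside $H$ and the
    induction hypothesis applies to the finitely many subgroups generated by
    $H$ and such a vector.  Or, for every $r$, some $K_r$ identifies no more
    words of length at most $r$ than $H$ does: then its $r$-ball projects onto
    the $r$-ball of any other $K$, and as both have $\beta(r)$ elements, this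
    projection is injective ([coarser_image_inj]) and $K$ agrees with $H$ on
    that ball.  As $r$ is arbitrary, $H$ is then the only possible $K$. *)

Set Implicit Arguments.
Unset Strict Implicit.
Unset Printing Implicit Defensive.

Local Open Scope classical_set_scope.

(** * Noetherian abelian groups *)

Section Noetherian.
Import GRing.Theory Num.Theory.
Local Open Scope ring_scope.

Definition subgroup (M : zmodType) (H : set M) : Prop :=
  H 0 /\ forall x y, H x -> H y -> H (x - y).

Lemma subgroupN (M : zmodType) (H : set M) x : subgroup H -> H x -> H (- x).
Proof. by case=> H0 HB Hx; rewrite -sub0r; apply: HB. Qed.

Lemma subgroupD (M : zmodType) (H : set M) x y :
  subgroup H -> H x -> H y -> H (x + y).
Proof.
by move=> sH Hx Hy; rewrite -[y]opprK; apply: sH.2 => //; apply: subgroupN.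
Qed.

Lemma subgroupMz (M : zmodType) (H : set M) x (m : int) :
  subgroup H -> H x -> H (x *~ m).
Proof.
move=> sH Hx; have Hn k : H (x *+ k).
  elim: k => [|k IHk]; first by rewrite mulr0n; exact: sH.1.
  by rewrite mulrS; apply: subgroupD.
case: m => k; first exact: Hn.
by apply: subgroupN => //; exact: Hn.
Qed.

Definition above (M : zmodType) (K H : set M) : Prop :=
  [/\ subgroup H, subgroup K & H `<` K].

Lemma above_witness (M : zmodType) (K H : set M) :
  above K H -> exists2 x, K x & ~ H x.
Proof.
move=> [_ _ [_ nKH]]; apply: contrapT => nex; apply: nKH => x Kx.
by apply: contrapT => nHx; apply: nex; exists x.
Qed.

(** The relation reads `K is above H', so that its well-foundedness is the
    ascending chain condition. *)
Definition noetherian (M : zmodType) : Prop := well_founded (@above M).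

(** A subgroup $H$ of the middle term of an exact sequence is determined,
    within any subgroup containing it, by its image in the quotient and its
    trace on the kernel.  A strictly larger subgroup thus enlarges one of
    these, and the lexicographic order on the two is well founded. *)
Lemma noetherian_ext (A M B : zmodType) (q : A -> M) (p : M -> B) :
  zmod_morphism q -> zmod_morphism p ->
  (forall x, p x = 0 -> exists z, x = q z) ->
  noetherian A -> noetherian B -> noetherian M.
Proof.
move=> qB pB exact_pq noethA noethB.
have q0 : q 0 = 0 by rewrite -(subrr 0) qB subrr.
have p0 : p 0 = 0 by rewrite -(subrr 0) pB subrr.
have subP (H : set M) : subgroup H -> subgroup (p @` H).
  move=> sH; split; first by exists 0 => //; exact: sH.1.
  by move=> _ _ [x Hx <-] [y Hy <-]; exists (x - y); [exact: sH.2|rewrite pB].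
have subQ (H : set M) : subgroup H -> subgroup (q @^-1` H).
  move=> sH; split; first by rewrite /= q0; exact: sH.1.
  by move=> x y Hx Hy; rewrite /= qB; exact: sH.2.
suff acc P : forall Q H, p @` H = P -> q @^-1` H = Q -> Acc (@above M) H.
  by move=> H; exact: (acc (p @` H)).
elim/(well_founded_ind noethB): P => P IHP.
elim/(well_founded_ind noethA) => Q IHQ H HP HQ.
constructor=> K [sH sK [HK nKH]].
have [eqP|neqP] := pselect (p @` K `<=` P); last first.
  apply: (IHP (p @` K)) => //; split; rewrite -?HP; try exact: subP.
  by split; [exact: image_subset | rewrite HP].
apply: (IHQ (q @^-1` K)) => //; last first.
  by apply/seteqP; split => //; rewrite -HP; exact: image_subset.
split; rewrite -?HQ; try exact: subQ.
split=> [x|KQ]; first exact: HK.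
apply: nKH => x Kx.
have [y Hy pyx] : (p @` H) (p x) by rewrite HP; apply: eqP; exists x.
have [|z xyz] := exact_pq (x - y); first by rewrite pB pyx subrr.
rewrite -[x](subrK y); apply: subgroupD => //.
by rewrite xyz; apply: KQ; rewrite /= -xyz; apply: sK.2 => //; exact: HK.
Qed.

(** Euclidean division: if $n > 0$ belongs to $H$ and $x$ lies in a larger
    subgroup but not in $H$, the remainder of $x$ modulo $n$ is a smaller
    positive element of that larger subgroup. *)
Lemma noetherian_int : noetherian int.
Proof.
have acc n : forall H : set int, H n.+1%:Z -> Acc (@above int) H.
  elim/ltn_ind: n => n IHn H Hn; constructor=> K aboveHK.
  have [[sH sK [HK _]] [x Kx nHx]] := (aboveHK, above_witness aboveHK).
  have Hdiv : H ((x %/ n.+1)%Z * n.+1%:Z).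
    by rewrite mulrC -mulrzz; exact: subgroupMz.
  have Kr : K (x %% n.+1)%Z by rewrite /modz; apply: sK.2 => //; exact: HK.
  have rlt : (x %% n.+1)%Z < n.+1%:Z by exact: ltz_pmod.
  have r_ge0 : 0 <= (x %% n.+1)%Z by exact: modz_ge0.
  have [r er] : exists r : nat, (x %% n.+1)%Z = r.
    by exists `|(x %% n.+1)%Z|%N; rewrite gez0_abs.
  rewrite er in rlt Kr; case: r => [|r] in er rlt Kr.
    by case: nHx; rewrite (divz_eq x n.+1) er addr0.
  by apply: (IHn r).
(* A subgroup above any other one contains a nonzero, hence a positive,
   integer. *)
move=> H; constructor=> K aboveHK.
have [[sH sK _] [x Kx nHx]] := (aboveHK, above_witness aboveHK).
case: x Kx nHx => [[|n]|n] Kx nHx.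
- by case: nHx; exact: sH.1.
- exact: acc Kx.
- by apply: (acc n); rewrite -[n.+1%:Z]opprK -NegzE; apply: subgroupN.
Qed.

Lemma noetherian_lattice n : noetherian {ffun 'I_n -> int}.
Proof.
elim: n => [|n IHn].
  move=> H; constructor=> K [[H0 _] _ [_ nKH]]; case: nKH => x _.
  by have -> : x = 0 by apply/ffunP; case.
pose q (f : {ffun 'I_n -> int}) : {ffun 'I_n.+1 -> int} :=
  [ffun i => if unlift ord0 i is Some j then f j else 0].
pose p (f : {ffun 'I_n.+1 -> int}) : int := f ord0.
apply: (@noetherian_ext _ _ _ q p) IHn noetherian_int.
- move=> f g; apply/ffunP=> i; rewrite !ffunE.
  by case: unliftP => [j|] _; rewrite ?ffunE ?subr0.
- by move=> f g; rewrite /p !ffunE.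
- move=> f f0; exists [ffun j => f (lift ord0 j)]; apply/ffunP=> i.
  by rewrite ffunE; case: unliftP => [j|] ->; rewrite ?ffunE.
Qed.

Definition adjoin (M : zmodType) (H : set M) (v : M) : set M :=
  [set x | exists2 h, H h & exists m : int, x = h + v *~ m].

Lemma adjoin_above (M : zmodType) (H : set M) v :
  subgroup H -> ~ H v -> above (adjoin H v) H.
Proof.
move=> sH nHv; split=> //.
  split; first by exists 0; [exact: sH.1 | exists 0; rewrite mulr0z addr0].
  move=> _ _ [h Hh [m ->]] [h' Hh' [m' ->]]; exists (h - h'); first exact: sH.2.
  by exists (m - m'); rewrite mulrzBr addrACA opprD.
split=> [h Hh|]; first by exists h => //; exists 0; rewrite mulr0z addr0.
move=> sub; apply: nHv; apply: sub.
by exists 0; [exact: sH.1 | exists 1; rewrite add0r].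
Qed.

Lemma adjoin_sub (M : zmodType) (H K : set M) v :
  subgroup K -> H `<=` K -> K v -> adjoin H v `<=` K.
Proof.
move=> sK HK Kv _ [h Hh [m ->]].
by apply: subgroupD; [|exact: HK|exact: subgroupMz].
Qed.

End Noetherian.

(** * Words and the lattice of relations of a commutative group *)

Section Words.
Import GRing.Theory Num.Theory.
Local Open Scope ring_scope.

Definition exponents n (w : seq 'I_n) : {ffun 'I_n -> int} :=
  [ffun i => (count_mem i w)%:Z].

Lemma exponents_cat n (v w : seq 'I_n) :
  exponents (v ++ w) = exponents v + exponents w.
Proof. by apply/ffunP=> i; rewrite !ffunE count_cat PoszD. Qed.

Lemma exponents_perm n (v w : seq 'I_n) :
  exponents v = exponents w -> perm_eq v w.
Proof.
move=> /ffunP vw; apply/allP=> i _ /=.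
by have := vw i; rewrite !ffunE => -[->].
Qed.

Definition eval (G : groupType) n (g : 'I_n -> G) (w : seq 'I_n) : G :=
  (\prod_(i <- w) g i)%g.

Lemma eval_cat (G : groupType) n (g : 'I_n -> G) v w :
  eval g (v ++ w) = (eval g v * eval g w)%g.
Proof. exact: big_cat. Qed.

Definition commutative_group (G : groupType) : Prop :=
  forall x y : G, (x * y = y * x)%g.

Lemma eval_perm (G : groupType) n (g : 'I_n -> G) v w :
  commutative_group G -> perm_eq v w -> eval g v = eval g w.
Proof.
move=> comG; apply: catCA_perm_subst => s1 s2 s3.
by rewrite !eval_cat !mulgA (comG (eval g s1)).
Qed.

(** The kernel of the morphism from the free abelian group that extends [g].
    Differences of words exhaust that group, so that the vectors mapped to the
    neutral element are described by pairs of words with the same value. *)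
Definition kernel (G : groupType) n (g : 'I_n -> G) : set {ffun 'I_n -> int} :=
  [set x | exists v w, eval g v = eval g w /\ x = exponents v - exponents w].

(** Two pairs of words with the same difference of exponents differ by a
    permutation of letters after crosswise concatenation, which evaluation in a
    commutative group does not see. *)
Lemma kernelP (G : groupType) n (g : 'I_n -> G) v w : commutative_group G ->
  kernel g (exponents v - exponents w) <-> eval g v = eval g w.
Proof.
move=> comG; split=> [[v' [w' [evw' /eqP]]]|]; last by exists v, w.
rewrite subr_eq addrAC eq_sym subr_eq -!exponents_cat => /eqP/exponents_perm.
move=> /(eval_perm g comG); rewrite !eval_cat evw' (comG (eval g v)).
by move=> /mulgI.
Qed.

Lemma subgroup_kernel (G : groupType) n (g : 'I_n -> G) :
  commutative_group G -> subgroup (kernel g).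
Proof.
move=> comG; split; first by exists [::], [::]; rewrite subrr.
move=> _ _ [v [w [evw ->]]] [v' [w' [evw' ->]]].
exists (v ++ w'), (w ++ v'); split; first by rewrite !eval_cat evw evw'.
by rewrite !exponents_cat opprB opprD addrACA [_ - exponents v']addrC.
Qed.

End Words.

Definition generates (G : groupType) n (g : 'I_n -> G) : Prop :=
  forall x, exists w, eval g w = x.

(** Words represent the elements of both groups; choosing a representative in
    each direction gives mutually inverse maps, because equality of values is
    the same relation on words on both sides. *)
Lemma kernel_isomorphic (G H : groupType) n (g : 'I_n -> G) (h : 'I_n -> H) :
  generates g -> generates h ->
  (forall v w, eval g v = eval g w <-> eval h v = eval h w) ->
  isomorphic G H.
Proof.
move=> /choice[wg wgK] /choice[wh whK] gh.
pose f x := eval h (wg x).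
have fM : {morph f : x y / (x * y)%g}.
  by move=> x y; rewrite /f -eval_cat; apply/gh; rewrite eval_cat !wgK.
pose F : {multiplicative G -> H} :=
  HB.pack f (isMultiplicative.Build G H f fM).
exists F; exists (fun y => eval g (wh y)) => z /=.
  by rewrite -[RHS]wgK; apply/gh; rewrite whK.
by rewrite -[RHS]whK; apply/gh; rewrite wgK.
Qed.

(** * Growth of a generating family *)

Definition family_ball (G : groupType) n (g : 'I_n -> G) r : {fset G} :=
  [fset eval g (w : r.-bseq 'I_n) | w in {: r.-bseq 'I_n}]%fset.

(** The second map factors through the first, inducing a surjection between
    images of the same cardinality, which is therefore injective. *)
Lemma coarser_image_inj (T : finType) (A B : choiceType)
    (f : T -> A) (h : T -> B) :
  (forall s t, f s = f t -> h s = h t) ->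
  #|` [fset f t | t in T]|%fset = #|` [fset h t | t in T]|%fset ->
  forall s t, h s = h t -> f s = f t.
Proof.
move=> fh card_fh s t hst.
pose k a := h (odflt s [pick u | f u == a]).
have kf u : k (f u) = h u.
  rewrite /k; case: pickP => [v /eqP/fh //|/(_ u)]; by rewrite eqxx.
have imk : (k @` [fset f t | t in T] = [fset h t | t in T])%fset.
  apply/fsetP=> b; apply/imfsetP/imfsetP => /=.
    by move=> [a /imfsetP[/= u _ ->] ->]; exists u; rewrite ?kf.
  by move=> [u _ ->]; exists (f u); rewrite ?kf // in_imfset.
have /eqP/card_in_imfsetP injk :
    (#|` k @` [fset f t | t in T]| = #|` [fset f t | t in T]|)%fset.
  by rewrite imk card_fh.
by apply: injk; rewrite ?in_imfset // !kf.
Qed.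

Definition has_growth (G : groupType) n (g : 'I_n -> G) (beta : nat -> nat) :
    Prop :=
  forall r, #|` family_ball g r|%fset = beta r.

Lemma word_ballP (G : groupType) (S : {fset G}) (hS : monoid_generates S) r x :
  word_ball hS r x <-> exists2 m, (m <= r)%N & is_word_product S m x.
Proof.
rewrite /word_ball /= /word_dist; case: ex_minnP => n.
rewrite invg1 mul1g => /asboolP nx min_n; split; first by exists n.
by case=> m mr mx; apply: leq_trans mr; apply: min_n; apply/asboolP.
Qed.

Lemma word_ball1 (G : groupType) (S : {fset G}) (hS : monoid_generates S) :
  word_ball hS 0 1%g.
Proof.
by apply/word_ballP; exists 0%N => //; exists [tuple]; rewrite big_nil.
Qed.

Lemma word_ballM (G : groupType) (S : {fset G}) (hS : monoid_generates S)
    a b x y :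
  word_ball hS a x -> word_ball hS b y -> word_ball hS (a + b) (x * y)%g.
Proof.
move=> /word_ballP[m ma [s [sS ->]]] /word_ballP[l lb [t [tS ->]]].
apply/word_ballP; exists (m + l)%N; first exact: leq_add.
exists [tuple of s ++ t]; rewrite big_cat; split=> // z.
by rewrite mem_cat => /orP[/sS|/tS].
Qed.

(** The generators are indexed by the whole ball of radius 1, that is $S$
    together with the neutral element: its size is read off from the growth
    function, whereas $|S|$ depends on whether $S$ contains that element. *)
Lemma ball_family (G : groupType) (S : {fset G}) (hS : monoid_generates S) :
  exists g : 'I_(growth hS 1) -> G, generates g /\ has_growth g (growth hS).
Proof.
pose B := fset_set (word_ball hS 1).
have memB x : (x \in B) = `[< word_ball hS 1 x >].
  by rewrite in_fset_set ?inE //; exact: finite_word_ball.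
pose g (i : 'I_(growth hS 1)) : G := nth 1%g B i.
have gB i : word_ball hS 1 (g i).
  by apply/asboolP; rewrite -memB; apply: mem_nth.
have Sg x : x \in S -> exists i, g i = x.
  move=> xS; have xB : x \in B.
    rewrite memB; apply/asboolP/word_ballP; exists 1%N => //.
    by exists [tuple x]; rewrite big_seq1; split=> // y; rewrite inE => /eqP->.
  have lt_i : (index x B < growth hS 1)%N by rewrite index_mem.
  by exists (Ordinal lt_i); rewrite /g nth_index.
have evalS s : {subset s <= S} ->
    exists2 w, size w = size s & eval g w = (\prod_(x <- s) x)%g.
  elim: s => [|x s IHs] sS.
    by exists [::]; rewrite // /eval !big_nil.
  have [|w sw ew] := IHs; first by move=> y ys; apply: sS; rewrite inE ys orbT.
  have [|i gi] := Sg x; first by apply: sS; rewrite mem_head.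
  by exists (i :: w); rewrite /= ?sw // /eval !big_cons gi -ew.
have evalB w : word_ball hS (size w) (eval g w).
  elim: w => [|i w IHw]; first by rewrite /eval big_nil; exact: word_ball1.
  by rewrite /eval big_cons; exact: (word_ballM (gB i) IHw).
exists g; split=> [x|r].
  by have [n [s [sS ->]]] := hS x; have [w _ <-] := evalS s sS; exists w.
congr #|` _|%fset; apply/fsetP=> x.
rewrite in_fset_set ?inE; last exact: finite_word_ball.
apply/imfsetP/asboolP => /= [[w _ ->]|].
  have /word_ballP[m mw em] := evalB w.
  by apply/word_ballP; exists m => //; apply: leq_trans mw (size_bseq w).
case/word_ballP => m mr [s [sS ->]]; have [w sw <-] := evalS s sS.
have wr : (size w <= r)%N by rewrite sw size_tuple.
by exists (Bseq wr).
Qed.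

(** * Finitely many isomorphism types *)

Definition finitely_many_types (P : groupType -> Prop) : Prop :=
  exists (k : nat) (L : 'I_k -> groupType),
    forall G, P G -> exists i, isomorphic G (L i).

Lemma finitely_many_types_sub (P Q : groupType -> Prop) :
  (forall G, P G -> Q G) -> finitely_many_types Q -> finitely_many_types P.
Proof. by move=> PQ [k [L hL]]; exists k, L => G /PQ; exact: hL. Qed.

Lemma finitely_many_types0 : finitely_many_types (fun=> False).
Proof.
have L : 'I_0 -> groupType by case.
by exists 0%N, L.
Qed.

Lemma finitely_many_typesU (P Q : groupType -> Prop) :
  finitely_many_types P -> finitely_many_types Q ->
  finitely_many_types (fun G => P G \/ Q G).
Proof.
move=> [k [L hL]] [l [M hM]].
exists (k + l)%N, (fun i : 'I_(k + l) =>
  match fintype.split i with inl j => L j | inr j => M j end).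
move=> G [/hL[i Gi]|/hM[i Gi]].
- exists (unsplit (inl i)); by rewrite unsplitK.
- exists (unsplit (inr i)); by rewrite unsplitK.
Qed.

Lemma finitely_many_types_bigcup (T : finType) (P : T -> groupType -> Prop) :
  (forall t, finitely_many_types (P t)) ->
  finitely_many_types (fun G => exists t, P t G).
Proof.
move=> finP.
suff fins (s : seq T) :
    finitely_many_types (fun G => exists2 t, t \in s & P t G).
  apply: finitely_many_types_sub (fins (enum T)) => G [t PtG].
  by exists t => //; rewrite mem_enum.
elim: s => [|t s IHs].
  by apply: finitely_many_types_sub finitely_many_types0 => G [].
apply: finitely_many_types_sub (finitely_many_typesU (finP t) IHs).
move=> G [u]; rewrite inE => /orP[/eqP->|us] PuG; first by left.
by right; exists u.
Qed.

Definition marked_growth n (beta : nat -> nat) (H : set {ffun 'I_n -> int})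
    (G : groupType) (g : 'I_n -> G) : Prop :=
  [/\ commutative_group G, generates g, has_growth g beta & H `<=` kernel g].

(** The groups counted here are compared with each other, through words: the
    quotient of the lattice by [H] may fail to have growth [beta], and is not
    a reference whose balls could be counted. *)
Lemma finitely_many_marked_growth n (beta : nat -> nat)
    (H : set {ffun 'I_n -> int}) :
  subgroup H ->
  finitely_many_types (fun G => exists g : 'I_n -> G, marked_growth beta H g).
Proof.
elim/(well_founded_ind (@noetherian_lattice n)): H => H IH sH.
pose diff (v w : seq 'I_n) := (exponents v - exponents w)%R.
have [[r coll]|ncoll] := pselect (exists r,
    forall (G : groupType) (g : 'I_n -> G), marked_growth beta H g ->
    exists v w : r.-bseq 'I_n, eval g v = eval g w /\ ~ H (diff v w)).
  (* Each marked group satisfies a new relation from a finite list, indexed by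
     the pairs of words of length at most [r]. *)
  pose P (vw : r.-bseq 'I_n * r.-bseq 'I_n) (G : groupType) :=
    ~ H (diff vw.1 vw.2) /\
    exists g : 'I_n -> G, marked_growth beta (adjoin H (diff vw.1 vw.2)) g.
  apply: (@finitely_many_types_sub _ (fun G => exists vw, P vw G)).
    move=> G [g mg]; have [v [w [evw nHvw]]] := coll G g mg.
    exists (v, w); split=> //; exists g; case: mg => comG gen gro Hker.
    split=> //; apply: adjoin_sub => //; first exact: subgroup_kernel.
    exact/kernelP.
  apply: finitely_many_types_bigcup => vw.
  have [Hvw|nHvw] := pselect (H (diff vw.1 vw.2)).
    by apply: finitely_many_types_sub finitely_many_types0 => G [].
  have above_vw := adjoin_above sH nHvw.
  have [_ sub_vw _] := above_vw.
  by apply: finitely_many_types_sub (IH _ above_vw sub_vw) => G [].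
(* From here on, all the marked groups have relation subgroup [H]. *)
have inj r : exists (G : groupType) (g : 'I_n -> G), marked_growth beta H g /\
    forall v w : r.-bseq 'I_n, eval g v = eval g w -> H (diff v w).
  apply: contrapT => nex; apply: ncoll; exists r => G g mg.
  apply: contrapT => nvw; apply: nex; exists G, g; split=> // v w evw.
  by apply: contrapT => nHvw; apply: nvw; exists v, w.
have evalH (G : groupType) (g : 'I_n -> G) v w : marked_growth beta H g ->
    eval g v = eval g w <-> H (diff v w).
  move=> [comG gen gro Hker]; split=> [evw|/Hker/kernelP -> //].
  pose r := maxn (size v) (size w).
  have [G' [g' [[comG' _ gro' Hker'] inj']]] := inj r.
  have vr : (size v <= r)%N by exact: leq_maxl.
  have wr : (size w <= r)%N by exact: leq_maxr.
  apply: (inj' (Bseq vr) (Bseq wr)).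
  apply: (@coarser_image_inj _ _ _ (fun w : r.-bseq 'I_n => eval g' w)
    (fun w : r.-bseq 'I_n => eval g w) _ _ (Bseq vr) (Bseq wr)) => //.
    by move=> s t /inj'/Hker/kernelP->.
  by rewrite [LHS]gro' [RHS]gro.
have [G0 [g0 [mg0 _]]] := inj 0%N.
exists 1%N, (fun=> G0) => G [g mg]; exists ord0.
have [_ gen _ _] := mg; have [_ gen0 _ _] := mg0.
by apply: (kernel_isomorphic gen gen0) => v w; rewrite !evalH.
Qed.

Theorem corollary1p7 (beta : nat -> nat) :
  exists (k : nat) (L : 'I_k -> groupType),
    forall G : groupType,
      (forall x y : G, (x * y)%g = (y * x)%g) ->
      finitely_generated G ->
      (exists (S : {fset G}) (hS : monoid_generates S), growth hS = beta) ->
      exists i : 'I_k, isomorphic G (L i).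
Proof.
have sub0 : subgroup [set 0%R : {ffun 'I_(beta 1) -> int}].
  by split=> // _ _ -> ->; rewrite GRing.subr0.
have [k [L hL]] := finitely_many_marked_growth beta sub0.
exists k, L => G comG _ [S [hS eq_beta]]; apply: hL.
have [g [gen gro]] := ball_family hS; rewrite eq_beta in g gen gro.
exists g; split=> // _ ->; exact: (subgroup_kernel g comG).1.
Qed.
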